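(* Let $d,s\ge1$ be integers and $C_0\ge1$. There are constants $C_1\ge1$ and $c>1$ depending only on $d,s,C_0$ such that the following holds. Let $A,M\ge2$ and $N\ge1$ be integers with $AM>d$. Let $\mathfrak g$ be a real nilpotent Lie algebra of dimension $d$ with filtration $\mathfrak g_\bullet$ of step $s$, rational basis $\mathcal X$ and rational structure constants of height at most $M$. Let $p(n)=\sum_{i=1}^sa_in^i$ be a polynomial sequence adapted to $\mathfrak g_\bullet$, and let $S_\bullet=(S_i)_{i=1}^s$ be a sequence of subspaces with $S_i\le\mathfrak g_i$, where all $S_i$ and all $\mathfrak g_i$ are rational subspaces of complexity at most $A^{C_0}$ in $\mathfrak g$. Then we may write $p=e*p'*r$, where $e,p',r$ are polynomial sequences in $\mathfrak g$ adapted to $\mathfrak g_\bullet$, $p'$ is $(A,N)$-linearly irrational in a sequence $S'_\bullet$ of rational subspaces of complexity at most $A^{C_1}$, $r$ is $(AM)^{C_1}$-rational, and $e$ is $((AM)^{C_1},N)$-small. Furthermore: (i) if $j$ is the smallest integer such that $a_j$ is not $(A,A/N^j)$-linearly irrational in $S_j$, then we may take $S'_k=S_k$ for all $k=1,\dots,j-1$ and $S'_j$ strictly contained in $S_j$; (ii) if $B>AM$ and $p$ is $(B^c,N)$-filtration irrational in $\mathfrak g_\bullet$, then $p'$ is $(B,N)$-filtration irrational in $\mathfrak g_\bullet$.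
   Context: $x*y:=\log(\exp x\exp y)$ (group law of the simply connected Lie group of $\mathfrak g$ transported to $\mathfrak g$); products of polynomial sequences are pointwise. A basis is rational if its structure constants are rational; height of $a/b$ in lowest terms is $\max(|a|,|b|)$. Filtration of step $s$: Lie subalgebras $\mathfrak g=\mathfrak g_0=\mathfrak g_1\ge\dots\ge\mathfrak g_s$ with $[\mathfrak g_i,\mathfrak g_j]\le\mathfrak g_{i+j}$, $\mathfrak g_k=0$ for $k>s$; a polynomial sequence $\sum_{i=1}^sc_in^i$ is adapted if $c_i\in\mathfrak g_i$. $\mathfrak g_{\mathbb Q}=\mathrm{span}_{\mathbb Q}\mathcal X$; rational subspace = common kernel of linear maps sending $\mathfrak g_{\mathbb Q}$ into $\mathbb Q$; integer linear map = linear $l$ with $l(\mathcal X)\subset\mathbb Z$; Hermite basis $\mathcal X'_S$ of rational $S$ = the $\mathbb Z$-basis of $S\cap\mathrm{span}_{\mathbb Z}\mathcal X$ whose $\mathcal X$-coordinate matrix is in Hermite normal form; complexity of integer linear $l$ on $S$ = $\max_{x\in\mathcal X'_S}|l(x)|$; a proper rational subspace has complexity $\le C$ if it is a common kernel of integer linear maps of complexity $\le C$ on $\mathfrak g$ ($\mathfrak g$ has complexity 1). $a\in S$ is $(B,\delta)$-linearly irrational in $S$ if $\|l(a)\|_{\mathbb R/\mathbb Z}\ge\delta$ for all integer linear $l$ nontrivial on $S$ of complexity $\le B$ on $S$; a polynomial sequence $\sum_ic_in^i$ is $(B,N)$-linearly irrational in $S'_\bullet$ if each $c_i$ is $(B,B/N^i)$-linearly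 irrational in $S'_i$. $\mathfrak h_i$ = smallest Lie subalgebra containing $\mathfrak g_{i+1}$ and $[\mathfrak g_j,\mathfrak g_{i-j}]$ for $0\le j\le i$. $c\in\mathfrak g_i$ is $(B,\delta)$-filtration irrational if $\|l(c)\|_{\mathbb R/\mathbb Z}\ge\delta$ for all integer linear $l$ nontrivial on $\mathfrak g_i$, of complexity $\le B$ on $\mathfrak g_i$, vanishing on $\mathfrak h_i$; a sequence is $(B,N)$-filtration irrational if its degree-$i$ coefficient is $(B,B/N^i)$-filtration irrational for each $i$. A polynomial sequence $\sum_ic_in^i$ is $R$-rational if all $\mathcal X$-coordinates of all $c_i$ lie in $\frac1R\mathbb Z$, and $(B,N)$-small if all $\mathcal X$-coordinates of $c_i$ have absolute value $\le B/N^i$.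
   Formalization: ''(AM)^{C_1}-rational'' is read as Q-rational for some positive integer Q ≤ (AM)^{C_1} (with denominator exactly (AM)^{C_1} the claim is false), and (i) assumes a_j ∈ S_j, where linear irrationality in S_j is defined (it fails for S_j = 0, a_j ≠ 0). *)

(* Defs.v *)
From HB Require Import structures.
From mathcomp Require Import all_boot all_order all_algebra.
From mathcomp Require Import reals exp.

Set Implicit Arguments.
Unset Strict Implicit.
Unset Printing Implicit Defensive.

Import Order.TTheory GRing.Theory Num.Theory.
Local Open Scope ring_scope.

(* Noncommutative formal power series over rat in two letters: a series is its
   coefficient function on words; the letter X is [false], the letter Y is
   [true]. *)
Definition ncseries := seq bool -> rat.

Definition ncs_one : ncseries := fun w => (w == [::])%:R.

Definition ncs_mul (f g : ncseries) : ncseries :=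
  fun w => \sum_(i < (size w).+1) f (take i w) * g (drop i w).

Definition ncs_exp (b : bool) : ncseries :=
  fun w => if all (pred1 b) w then ((size w)`!)%:R^-1 else 0.

(* log f = \sum_(k >= 1) (-1)^(k+1) (f - 1)^k / k for f with constant term 1.
   Since f - 1 has no constant term, only k <= size w contribute at w. *)
Definition ncs_log (f : ncseries) : ncseries :=
  fun w => \sum_(1 <= k < (size w).+1)
    (-1) ^+ k.+1 / k%:R * iter k (ncs_mul (fun v => f v - ncs_one v)) ncs_one w.

Definition bch_coef : ncseries :=
  ncs_log (ncs_mul (ncs_exp false) (ncs_exp true)).

Section LieAlgebra.
Variables (R : realType) (V : vectType R) (br : V -> V -> V).

(* [:: x1; ...; xn] |-> [x1, [x2, ..., [x(n-1), xn]]] *)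
Definition nested_bracket (xs : seq V) : V :=
  if xs is x :: xs' then foldr br (last x xs') (belast x xs') else 0.

Record lie_algebra : Prop := LieAlgebra {
  lie_linearl : forall a x y z, br (a *: x + y) z = a *: br x z + br y z;
  lie_linearr : forall a x y z, br z (a *: x + y) = a *: br z x + br z y;
  lie_alt : forall x, br x x = 0;
  lie_jacobi : forall x y z,
    br x (br y z) + br y (br z x) + br z (br x y) = 0 }.

Definition lie_nilpotent : Prop :=
  exists k : nat, forall xs : seq V,
    (k < size xs)%N -> nested_bracket xs = 0.

Definition lie_subalgebra (U : {vspace V}) : Prop :=
  forall x y, x \in U -> y \in U -> br x y \in U.

(* The group law log(exp x exp y) of the simply connected group, in exponential
   coordinates: the series log(exp X exp Y) is a Lie series, and by the
   Dynkin-Specht-Wever theorem its degree-n part is 1/n times the sum of its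
   words replaced by the corresponding nested brackets.  The terms of degree
   n > s are omitted: they vanish in a Lie algebra with a filtration of
   step s. *)
Definition bch (s : nat) (x y : V) : V :=
  \sum_(1 <= n < s.+1) n%:R^-1 *:
    \sum_(w : n.-tuple bool) ratr (bch_coef w) *:
      nested_bracket [seq (if b then y else x) | b <- w].

Record filtration (s : nat) (G : nat -> {vspace V}) : Prop := Filtration {
  filt0 : G 0%N = fullv;
  filt1 : G 1%N = fullv;
  filt_sub : forall i, lie_subalgebra (G i);
  filt_dec : forall i, (G i.+1 <= G i)%VS;
  filt_br : forall i j x y, x \in G i -> y \in G j -> br x y \in G (i + j)%N;
  filt_end : forall k, (s < k)%N -> G k = 0%VS }.

(* Membership in h_i, the smallest Lie subalgebra containing g_(i+1) and all
   [g_j, g_(i-j)]. *)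
Definition in_h (G : nat -> {vspace V}) (i : nat) (x : V) : Prop :=
  forall W : {vspace V}, lie_subalgebra W -> (G i.+1 <= W)%VS ->
    (forall j, (j <= i)%N ->
      forall y z, y \in G j -> z \in G (i - j)%N -> br y z \in W) ->
    x \in W.

End LieAlgebra.

(* The polynomial sequence \sum_(i = 1)^s c_i n^i is represented by its
   coefficients c : nat -> V; only the c i with 1 <= i <= s matter. *)
Section PolynomialSequences.
Variables (R : realType) (V : vectType R).

Definition poly_seq (s : nat) (c : nat -> V) (n : int) : V :=
  \sum_(1 <= i < s.+1) (n%:~R ^+ i : R) *: c i.

Definition adapted (s : nat) (G : nat -> {vspace V}) (c : nat -> V) : Prop :=
  forall i, (0 < i <= s)%N -> c i \in G i.

End PolynomialSequences.

Section Rationality.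
Variables (R : realType) (V : vectType R) (d : nat) (X : d.-tuple V).

Definition is_rational (x : R) : Prop := exists q : rat, x = ratr q.

Definition rat_height (q : rat) : nat := maxn `|numq q| `|denq q|.

Definition structure_constants_height_le (br : V -> V -> V) (M : nat) : Prop :=
  forall i j k : 'I_d, exists q : rat,
    coord X k (br X`_i X`_j) = ratr q /\ (rat_height q <= M)%N.

Definition rat_span (x : V) : Prop := forall k : 'I_d, is_rational (coord X k x).

Definition int_span (x : V) : Prop :=
  forall k : 'I_d, coord X k x \is a Num.int.

Definition rational_map (l : 'Hom(V, R^o)) : Prop :=
  forall x, rat_span x -> is_rational (l x).

Definition integer_map (l : 'Hom(V, R^o)) : Prop :=
  forall k : 'I_d, (l X`_k : R) \is a Num.int.

Definition common_kernel (ls : seq 'Hom(V, R^o)) (S : {vspace V}) : Prop :=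
  forall x, x \in S <-> (forall l, l \in ls -> l x = 0).

Definition rational_subspace (S : {vspace V}) : Prop :=
  exists ls : seq 'Hom(V, R^o),
    (forall l, l \in ls -> rational_map l) /\ common_kernel ls S.

(* Row-style Hermite normal form of a matrix without zero rows: row i has its
   first nonzero entry, which is positive, in column f i; f is increasing; the
   entries above a pivot are nonnegative and smaller than the pivot. *)
Definition hermite_normal_form m (H : 'M[R]_(m, d)) : Prop :=
  exists f : 'I_m -> 'I_d,
    [/\ forall i i' : 'I_m, (i < i')%N -> (f i < f i')%N,
        forall i, 0 < H i (f i),
        forall i (j : 'I_d), (j < f i)%N -> H i j = 0
      & forall i i' : 'I_m, (i' < i)%N -> 0 <= H i' (f i) < H i (f i)].

Definition hermite_basis (S : {vspace V}) (bs : seq V) : Prop :=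
  [/\ forall x, x \in bs -> x \in S /\ int_span x,
      free bs,
      forall x, x \in S -> int_span x ->
        exists z : 'I_(size bs) -> int, x = \sum_i (z i)%:~R *: bs`_i
    & hermite_normal_form (\matrix_(i < size bs, j < d) coord X j bs`_i)].

Definition map_complexity_le (S : {vspace V}) (l : 'Hom(V, R^o)) (C : R) : Prop :=
  exists2 bs, hermite_basis S bs & forall x, x \in bs -> `|l x : R| <= C.

Definition subspace_complexity_le (S : {vspace V}) (C : R) : Prop :=
  (S = fullv /\ 1 <= C) \/
  (S <> fullv /\ exists ls : seq 'Hom(V, R^o),
     (forall l, l \in ls -> integer_map l /\ map_complexity_le fullv l C) /\
     common_kernel ls S).

Definition nontrivial_on (S : {vspace V}) (l : 'Hom(V, R^o)) : Prop :=
  exists2 x, x \in S & l x <> 0.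

(* The distance ||x||_(R/Z) of x to the nearest integer. *)
Definition dist_int (x : R) : R :=
  let f := x - (Num.floor x)%:~R in Num.min f (1 - f).

Definition lin_irrational (S : {vspace V}) (B delta : R) (a : V) : Prop :=
  a \in S /\
  forall l : 'Hom(V, R^o), integer_map l -> nontrivial_on S l ->
    map_complexity_le S l B -> delta <= dist_int (l a).

Definition poly_lin_irrational (s : nat) (S : nat -> {vspace V}) (B : R)
    (N : nat) (c : nat -> V) : Prop :=
  forall i, (0 < i <= s)%N -> lin_irrational (S i) B (B / N%:R ^+ i) (c i).

Definition filt_irrational (br : V -> V -> V) (G : nat -> {vspace V}) (i : nat)
    (B delta : R) (a : V) : Prop :=
  a \in G i /\
  forall l : 'Hom(V, R^o), integer_map l -> nontrivial_on (G i) l ->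
    map_complexity_le (G i) l B -> (forall x, in_h br G i x -> l x = 0) ->
    delta <= dist_int (l a).

Definition poly_filt_irrational (br : V -> V -> V) (s : nat)
    (G : nat -> {vspace V}) (B : R) (N : nat) (c : nat -> V) : Prop :=
  forall i, (0 < i <= s)%N ->
    filt_irrational br G i B (B / N%:R ^+ i) (c i).

Definition poly_rational (s Q : nat) (c : nat -> V) : Prop :=
  forall i, (0 < i <= s)%N -> forall k : 'I_d,
    exists z : int, coord X k (c i) = z%:~R / Q%:R.

Definition poly_small (s : nat) (B : R) (N : nat) (c : nat -> V) : Prop :=
  forall i, (0 < i <= s)%N -> forall k : 'I_d,
    `|coord X k (c i)| <= B / N%:R ^+ i.

End Rationality.

(* Main.v *)
(* The coefficient of [n ^ k] in [bch (bch e p) r] is [e k + p k + r k] plus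
   iterated brackets of coefficients of lower index, which lie in h_k.  Hence
   the factorization can be solved one degree at a time: what is left of [a k]
   after subtracting the bracket terms is split linearly as [e k + p k + r k],
   and neither associativity of the group law nor any bound on the bracket
   terms is needed.  In degree k, as long as the current element of a rational
   subspace satisfies a relation l whose value is close to an integer, one
   subtracts a small and a rational multiple of an integer vector v with
   [l v <> 0] and passes to the kernel of l; the dimension drops each time.
   Complexities are controlled by writing rational subspaces as spans of bounded
   integer vectors, and by passing between spans and kernels by eliminating one
   linear form at a time.  For (ii), a bad relation l for [p k] yields the bad
   relation Q l for [a k], where Q is a common denominator of r. *)
Require Import Defs.
From HB Require Import structures.
From mathcomp Require Import all_boot all_order all_algebra.
From mathcomp Require Import boolp reals exp.
From mathcomp Require Import zify ring lra.
Import Order.TTheory GRing.Theory Num.Theory.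
Local Open Scope ring_scope.
Set Implicit Arguments.
Unset Strict Implicit.
Unset Printing Implicit Defensive.

(** * Integer vectors, linear forms and rational subspaces *)

Section RationalSubspaces.
Variables (R : realType) (V : vectType R) (d : nat) (X : d.-tuple V).
Hypothesis Xb : basis_of fullv X.

Definition int_bounded (D : R) (v : V) : Prop :=
  int_span X v /\ forall k, `|coord X k v| <= D.

Lemma hom_expand (l : 'Hom(V, R^o)) v :
  l v = \sum_k coord X k v * l X`_k :> R.
Proof.
rewrite {1}(coord_basis Xb (memvf v)) linear_sum.
by apply: eq_bigr => k _; rewrite linearZ.
Qed.

Lemma coord_X (k i : 'I_d) : coord X k X`_i = (i == k)%:R :> R.
Proof. by rewrite (coord_free i k (basis_free Xb)). Qed.

Lemma int_bounded_X i : (i < d)%N -> int_bounded 1 X`_i.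
Proof.
move=> id; split=> k; rewrite (coord_X k (Ordinal id)).
  exact: natr_int.
by case: eqP; rewrite ?normr1 ?normr0.
Qed.

Lemma int_map_int_span l v : integer_map X l -> int_span X v ->
  (l v : R) \is a Num.int.
Proof.
move=> lX vX; rewrite hom_expand; apply: rpred_sum => k _.
by rewrite rpredM // ?vX ?lX.
Qed.

Lemma hom_bound (l : 'Hom(V, R^o)) (E D : R) v :
  (forall k : 'I_d, `|l X`_k : R| <= E) -> (forall k, `|coord X k v| <= D) ->
  `|l v : R| <= d%:R * (E * D).
Proof.
move=> lE vD; rewrite hom_expand (le_trans (ler_norm_sum _ _ _))//.
rewrite mulr_natl -[X in _ *+ X]card_ord -sumr_const ler_sum// => k _.
by rewrite normrM mulrC ler_pM.
Qed.

(** * Cutting a span by the kernel of a linear form *)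

Definition line_through (v : V) (t : R^o) : V := (t : R) *: v.

Fact line_through_is_linear v : linear (line_through v).
Proof.
by move=> a t t'; rewrite /line_through scalerDl scalerA.
Qed.
HB.instance Definition _ v := GRing.isLinear.Build R R^o V *:%R
  (line_through v) (line_through_is_linear v).

(** Division-free projection onto the kernel of [l] along [v0]: clearing the denominator [l v0]
    keeps integer vectors integral. *)
Definition elim_along (l : 'Hom(V, R^o)) (v0 : V) : 'Hom(V, V) :=
  (l v0 *: \1 - (linfun (line_through v0) \o l))%VF.

Lemma elim_alongE l v0 x : elim_along l v0 x = l v0 *: x - l x *: v0.
Proof.
rewrite /elim_along add_lfunE opp_lfunE scale_lfunE id_lfunE comp_lfunE.
by rewrite lfunE.
Qed.

(** The image of [elim_along] lies in the kernel, and on the kernel the map is multiplication by the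
    nonzero scalar [l v0], hence onto. *)
Lemma span_kernel_cut (l : 'Hom(V, R^o)) (v0 : V) vs :
  v0 \in <<vs>>%VS -> l v0 != 0 ->
  <<map (elim_along l v0) vs>>%VS = (<<vs>> :&: lker l)%VS.
Proof.
move=> v0vs lv0; rewrite -limg_span; apply/eqP; rewrite eqEsubv.
apply/andP; split; apply/subvP => x.
  case/memv_imgP => y yvs ->; rewrite elim_alongE memv_cap memvB ?memvZ//=.
  by rewrite memv_ker linearB subr_eq0 !linearZ; apply/eqP/mulrC.
rewrite memv_cap memv_ker => /andP[xvs /eqP lx].
have -> : x = elim_along l v0 ((l v0)^-1 *: x).
  by rewrite linearZ /= elim_alongE lx scale0r subr0 scalerA mulVf ?scale1r.
by rewrite memv_img ?memvZ.
Qed.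

Lemma elim_along_int_bounded l v0 v (E D : R) :
  integer_map X l -> int_bounded D v0 -> int_bounded D v ->
  `|l v0 : R| <= E -> `|l v : R| <= E ->
  int_bounded (2 * E * D) (elim_along l v0 v).
Proof.
move=> lX [v0X v0D] [vX vD] lv0 lv; rewrite elim_alongE; split=> k;
  rewrite linearB !linearZ /=.
  by rewrite rpredB ?rpredM ?v0X ?vX ?int_map_int_span.
have -> : 2 * E * D = E * D + E * D by ring.
by rewrite (le_trans (ler_normB _ _))// !normrM lerD ?ler_pM.
Qed.

(** Growth of generators in one elimination: the values of [l] on vectors of size [D] are themselves
    proportional to [D], so the new size is quadratic in [D]. *)
Definition cut_bound (K : R) (D : R) : R := K * D ^+ 2.

Lemma iter_cut_bound_ge K D n : 1 <= K -> 1 <= D ->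
  D <= iter n (cut_bound K) D.
Proof.
move=> K1 D1; elim: n => //= n IH; apply: (le_trans IH).
rewrite /cut_bound; set y := iter _ _ _ in IH *.
have y1 : 1 <= y by apply: le_trans IH.
rewrite -{1}[y]mul1r ler_pM ?ler01//; first lra.
by rewrite expr2 -{1}[y]mul1r ler_pM // ?ler01; lra.
Qed.

Lemma iter_cut_bound_mono K D m n : 1 <= K -> 1 <= D -> (m <= n)%N ->
  iter m (cut_bound K) D <= iter n (cut_bound K) D.
Proof.
move=> K1 D1 /subnK <-; rewrite iterD iter_cut_bound_ge//.
exact: le_trans (iter_cut_bound_ge m K1 D1).
Qed.

Lemma dim_full : \dim (fullv : {vspace V}) = d.
Proof. by rewrite -(span_basis Xb) (eqP (basis_free Xb)) size_tuple. Qed.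

Lemma span_killed (l : 'Hom(V, R^o)) (vs : seq V) :
  (forall v, v \in vs -> l v = 0) -> forall x, x \in <<vs>>%VS -> l x = 0.
Proof.
move=> lvs x xvs; apply/eqP; rewrite -memv_ker; apply: subvP xvs.
by apply/span_subvP => v /lvs lv; rewrite memv_ker lv.
Qed.

Lemma not_killed (l : 'Hom(V, R^o)) (vs : seq V) :
  (exists2 v, v \in vs & l v != 0) \/ (forall v, v \in vs -> l v = 0).
Proof.
have [/hasP[v vvs lv]|/hasPn H] := boolP (has (fun v => l v != 0) vs).
  by left; exists v.
by right=> v /H; rewrite negbK => /eqP.
Qed.

Lemma dim_cut (S : {vspace V}) (l : 'Hom(V, R^o)) v0 :
  v0 \in S -> l v0 != 0 -> (\dim (S :&: lker l) < \dim S)%N.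
Proof.
move=> v0S lv0; rewrite ltn_neqAle dimvS ?capvSl// andbT.
apply: contra lv0 => /eqP eqd.
have /eqP E : (S :&: lker l == S)%VS by rewrite eqEdim capvSl eqd leqnn.
by move: v0S; rewrite -E memv_cap memv_ker => /andP[].
Qed.

(** Induction on the forms, starting from the basis [X]. A form that vanishes on the current span
    costs nothing, any other lowers the dimension; counting iterations by codimension makes the
    bound independent of the number of forms. *)
Lemma kernel_bounded_span (E : R) (ls : seq 'Hom(V, R^o)) :
  (0 < d)%N -> 1 <= E ->
  (forall l, l \in ls -> integer_map X l /\ forall k : 'I_d, `|l X`_k : R| <= E) ->
  exists2 vs : seq V,
    (forall v, v \in vs -> int_bounded
       (iter (d - \dim <<vs>>) (cut_bound (2 * d%:R * E)) 1) v)
    & common_kernel ls <<vs>>.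
Proof.
move=> d0 E1; have d1 : (1 : R) <= d%:R by rewrite ler1n.
have K1 : 1 <= 2 * d%:R * E.
  rewrite -[1]mul1r ler_pM ?ler01// -[1]mul1r ler_pM ?ler01//; lra.
elim: ls => [|l ls IH] lsE.
  exists (X : seq V) => [v|x]; last by rewrite (span_basis Xb) memvf.
  case/(nthP 0) => i; rewrite size_tuple => id <-.
  by rewrite (span_basis Xb) dim_full subnn; exact: int_bounded_X.
have [|vs vsD vsker] := IH.
  by move=> l' l'ls; apply: lsE; rewrite inE l'ls orbT.
have [lX lE] := lsE l (mem_head _ _).
have [[v0 v0vs lv0]|l0] := not_killed l vs; last first.
  exists vs => // x; split=> [xvs l'|H].
    rewrite inE => /orP[/eqP->|l'ls]; first exact: (span_killed l0).
    by have /(_ xvs) := (vsker x).1; apply.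
  by apply/vsker => l' l'ls; apply: H; rewrite inE l'ls orbT.
have v0S := memv_span v0vs.
exists (map (elim_along l v0) vs) => [v|x]; last first.
  rewrite span_kernel_cut// memv_cap memv_ker; split.
    case/andP=> /vsker H /eqP lx l'; rewrite inE => /orP[/eqP->//|]; exact: H.
  move=> H; rewrite H ?mem_head// eqxx andbT; apply/vsker => l' l'ls.
  by apply: H; rewrite inE l'ls orbT.
case/mapP => u uvs ->; rewrite span_kernel_cut//.
set m := (d - \dim <<vs>>)%N in vsD.
set D := iter m (cut_bound (2 * d%:R * E)) 1 in vsD.
have D1 : 1 <= D by apply: iter_cut_bound_ge.
have lB w : w \in vs -> `|l w : R| <= d%:R * (E * D).
  by move=> /vsD[_ wD]; apply: hom_bound.
have [uX uD] := elim_along_int_bounded lX (vsD _ v0vs) (vsD _ uvs)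
  (lB _ v0vs) (lB _ uvs).
split=> // k; apply: (le_trans (uD k)).
have -> : 2 * (d%:R * (E * D)) * D = iter m.+1 (cut_bound (2 * d%:R * E)) 1.
  by rewrite /= -/D /cut_bound; ring.
apply: iter_cut_bound_mono => //.
have := dim_cut v0S lv0.
have : (\dim <<vs>> <= d)%N by rewrite -dim_full dimvS ?subvf.
by rewrite /m; lia.
Qed.

(** The scalar product for which [X] is orthonormal. It turns bounded integer vectors into integer
    maps with the same bounds on [X], and so exchanges spans and kernels. *)
Definition dot (w : V) : 'Hom(V, R^o) :=
  \sum_k coord X k w *: linfun (coord X k : V -> R^o).

Lemma dotE w x : dot w x = \sum_k coord X k w * coord X k x :> R.
Proof.
by rewrite sum_lfunE; apply: eq_bigr => k _; rewrite !lfunE /= lfunE.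
Qed.

Lemma dotC w x : dot w x = dot x w.
Proof. by rewrite !dotE; apply: eq_bigr => k _; rewrite mulrC. Qed.

Lemma dot_X w (k : 'I_d) : dot w X`_k = coord X k w :> R.
Proof.
rewrite dotE (bigD1 k)//= coord_X eqxx mulr1 big1 ?addr0// => i ik.
by rewrite coord_X eq_sym (negPf ik) mulr0.
Qed.

Lemma hom_dot (l : 'Hom(V, R^o)) : exists w, forall x, l x = dot w x.
Proof.
exists (\sum_(k < d) (l X`_k : R) *: X`_k) => x.
rewrite hom_expand dotE; apply: eq_bigr => k _; rewrite mulrC; congr (_ * _).
rewrite linear_sum (bigD1 k)//= linearZ /= coord_X eqxx mulr1 big1 ?addr0//.
by move=> i ik; rewrite linearZ /= coord_X (negPf ik) mulr0.
Qed.

(** The form is a nonvanishing coordinate of [x - projv S x], composed with the projection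
    [\1 - projv S]. *)
Lemma dot_separates (S : {vspace V}) x : x \notin S ->
  exists2 w, (forall v, v \in S -> dot w v = 0) & dot w x != 0.
Proof.
move=> xS; pose y := x - projv S x.
have y0 : y != 0.
  by apply: contra xS; rewrite subr_eq0 => /eqP->; rewrite memv_proj.
have [k yk] : exists k, coord X k y != 0.
  apply/existsP; apply: contraR y0 => /existsPn H.
  rewrite (coord_basis Xb (memvf y)) big1// => k _.
  by have := H k; rewrite negbK => /eqP->; rewrite scale0r.
pose g : 'Hom(V, R^o) := (linfun (coord X k : V -> R^o) \o (\1 - projv S))%VF.
have gE z : g z = coord X k (z - projv S z).
  by rewrite !lfunE /= !lfunE /= !lfunE.
have [w gw] := hom_dot g; exists w => [v vS|]; rewrite -gw gE //.
by rewrite projv_id // subrr linear0.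
Qed.

(** Double orthogonality: the forms [dot v] cut out the orthogonal complement, which has a bounded
    spanning set [ws] by [kernel_bounded_span], and the forms [dot w] for [w] in [ws] cut out the
    original span. *)
Lemma span_bounded_kernel (D : R) (vs : seq V) : (0 < d)%N -> 1 <= D ->
  (forall v, v \in vs -> int_bounded D v) ->
  exists2 ls : seq 'Hom(V, R^o),
    (forall l, l \in ls -> integer_map X l /\ forall k : 'I_d,
       `|l X`_k : R| <= iter d (cut_bound (2 * d%:R * D)) 1)
    & common_kernel ls <<vs>>.
Proof.
move=> d0 D1 vsD.
have d1 : (1 : R) <= d%:R by rewrite ler1n.
have K1 : 1 <= 2 * d%:R * D.
  rewrite -[1]mul1r ler_pM ?ler01// -[1]mul1r ler_pM ?ler01//; lra.
have [l|ws wsD wsker] := kernel_bounded_span (E := D) (ls := map dot vs) d0 D1.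
  by case/mapP => v /vsD[vX vB] ->; split=> k; rewrite dot_X.
exists (map dot ws) => [l /mapP[w wws ->]|x].
  have [wX wB] := wsD w wws; split=> k; rewrite dot_X; first exact: wX.
  by apply: (le_trans (wB k)); apply: iter_cut_bound_mono; rewrite ?leq_subr.
split=> [xvs l /mapP[w wws ->]|H].
  apply: span_killed xvs => v vvs; rewrite dotC.
  by have /(_ (memv_span wws)) := (wsker w).1; apply; apply: map_f.
apply/negPn/negP => /dot_separates[w wvs]; rewrite dotC => /eqP; apply.
have : w \in <<ws>>%VS.
  apply/wsker => l /mapP[v vvs ->]; rewrite dotC; exact/wvs/memv_span.
by apply: span_killed => u uws; rewrite dotC; apply: H; apply: map_f.
Qed.


(** * Linear forms bounded on a Hermite basis *)

Lemma sum_pow2 n : \sum_(k < n) 2 ^+ k = 2 ^+ n - 1 :> R.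
Proof.
elim: n => [|n IH]; first by rewrite big_ord0 subrr.
by rewrite big_ord_recr /= IH exprS; ring.
Qed.

(* In echelon form the entries above a pivot are smaller than the pivot, so
   back substitution at most doubles the coefficients at each row, whatever
   the size of the Hermite basis. *)
Lemma hermite_map_bound (S : {vspace V}) (bs vs : seq V) (l : 'Hom(V, R^o))
    (D B : R) x :
  S = <<vs>>%VS -> (forall v, v \in vs -> int_span X v) ->
  hermite_basis X S bs -> 0 <= D -> 0 <= B ->
  (forall b, b \in bs -> `|l b : R| <= B) ->
  x \in S -> (forall k, `|coord X k x| <= D) ->
  `|l x : R| <= 2 ^+ d * D * B.
Proof.
move=> Svs vsX [bsS bsfree bsZ [f [fmono fpos fzero fpiv]]] D0 B0 lB xS xD.
have sz : (size bs <= d)%N by rewrite -(eqP bsfree) -dim_full dimvS ?subvf.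
(* A Hermite basis only generates the integer vectors of [S]; since [S] has integer generators, [bs]
   spans [S] over the reals. *)
have xbs : x \in <<bs>>%VS.
  move: xS; rewrite Svs; apply: subvP; apply/span_subvP => v vvs.
  have [|z ->] := bsZ v _ (vsX v vvs); first by rewrite Svs memv_span.
  by apply: memv_suml => i _; rewrite memvZ// memv_span ?mem_nth.
pose t i := coord (in_tuple bs) i x.
have xE : x = \sum_i t i *: bs`_i by exact: (coord_span (X := in_tuple bs)).
pose H i j : R := coord X j bs`_i.
(* Pivots are positive integers. *)
have Hpos (i : 'I_(size bs)) : 1 <= H i (f i).
  have Hi := fpos i; rewrite mxE in Hi.
  rewrite -[H _ _]gtr0_norm// norm_intr_ge1 ?gt_eqF//.
  by apply: (bsS bs`_i _).2; rewrite mem_nth.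
(* Row by row: in the pivot column [f i] the later rows vanish and the earlier entries are at most
   the pivot, so the coordinate [f i] of [x] bounds [t i] in terms of the earlier coefficients. *)
have tB n : forall i : 'I_(size bs), (i < n)%N -> `|t i| <= 2 ^+ i * D.
  elim: n => [//|n IH] i; rewrite ltnS leq_eqVlt => /orP[/eqP ni|]; last exact: IH.
  have := xD (f i); rewrite {1}xE linear_sum.
  under eq_bigr do rewrite linearZ.
  rewrite (bigD1 i)//= (bigID (fun i' : 'I_(size bs) => (i' < i)%N))/=.
  rewrite [X in _ + (_ + X)]big1 ?addr0; last first.
    move=> i' /andP[i'i]; rewrite -leqNgt leq_eqVlt => /orP[/eqP/val_inj ii'|].
      by rewrite ii' eqxx in i'i.
    by move=> /fmono /fzero; rewrite mxE => ->; rewrite mulr0.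
  set Sg := \sum_(_ < _ | _) _; rewrite -[coord X _ _]/(H i (f i)) => le1.
  have SgB : `|Sg| <= (2 ^+ i - 1) * D * H i (f i).
    rewrite (le_trans (ler_norm_sum _ _ _))// -sum_pow2 !mulr_suml.
    rewrite (big_ord_widen _ (fun k => 2 ^+ k * D * H i (f i)) (ltnW (ltn_ord i))).
    rewrite (eq_bigl (fun i' : 'I_(size bs) => (i' < i)%N)); last first.
      by move=> i'; rewrite /= andb_idl// => i'i; rewrite -val_eqE ltn_eqF.
    apply: ler_sum => i' i'i; rewrite normrM ler_pM// ?IH//.
      by rewrite -ni.
    by have := fpiv _ _ i'i; rewrite !mxE => /andP[h0 /ltW hle]; rewrite ger0_norm.
  have h0 : 0 < H i (f i) by apply: lt_le_trans (Hpos i).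
  rewrite -(ler_pM2r h0) -{1}[H i (f i)]gtr0_norm// -normrM.
  have -> : t i * H i (f i) = (t i * H i (f i) + Sg) - Sg by ring.
  rewrite (le_trans (ler_normB _ _))//.
  apply: (le_trans (lerD le1 SgB)).
  (* With the pivot [H >= 1], [D] is at most [D H], so the total is at most [2 ^ i D H]. *)
  rewrite -subr_ge0.
  have -> : 2 ^+ i * D * H i (f i) - (D + (2 ^+ i - 1) * D * H i (f i))
    = D * (H i (f i) - 1) by ring.
  by rewrite mulr_ge0// subr_ge0.
rewrite xE linear_sum (le_trans (ler_norm_sum _ _ _))//.
apply: (@le_trans _ _ ((2 ^+ size bs - 1) * D * B)).
  rewrite -sum_pow2 !mulr_suml; apply: ler_sum => i _.
  rewrite linearZ normrM ler_pM// ?(tB (size bs))//.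
  by rewrite lB ?mem_nth.
rewrite !ler_wpM2r//.
apply: (@le_trans _ _ (2 ^+ size bs)); first lra.
by rewrite ler_weXn2l// ler1n.
Qed.

End RationalSubspaces.

(** * Distance to the nearest integer *)

Section DistInt.
Variable R : realType.
Implicit Type x : R.

Lemma dist_int_attained x : exists m : int, dist_int x = `|x - m%:~R|.
Proof.
rewrite /dist_int; set fl := Num.floor x.
have h0 : 0 <= x - fl%:~R by rewrite subr_ge0 floor_le_tmp.
have h1 : x < (fl + 1)%:~R by apply: floorD1_gt.
rewrite minEle; case: ifP => _; first by exists fl; rewrite ger0_norm.
exists (fl + 1); rewrite ltr0_norm ?subr_lt0//.
by rewrite intrD; ring.
Qed.

Lemma dist_int_le x (m : int) : dist_int x <= `|x - m%:~R|.
Proof.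
rewrite /dist_int; set fl := Num.floor x.
have h0 : 0 <= x - fl%:~R by rewrite subr_ge0 floor_le_tmp.
rewrite ge_min; have [mfl|flm] := leP m fl; apply/orP; [left|right].
  rewrite (le_trans _ (ler_norm _))// lerD2l lerN2 ler_int//.
rewrite distrC (le_trans _ (ler_norm _))//.
have : (fl + 1)%:~R <= m%:~R :> R by rewrite ler_int lezD1.
rewrite intrD; lra.
Qed.

End DistInt.

(** * Splitting a vector into small, irrational and rational parts *)

Section Decomposition.
Variables (R : realType) (V : vectType R) (d : nat) (X : d.-tuple V).
Hypothesis Xb : basis_of fullv X.

Lemma int_quotientP (x : R) (q : nat) : (0 < q)%N ->
  x * q%:R \is a Num.int <-> exists z : int, x = z%:~R / q%:R.
Proof.
move=> q0; have q1 : (q%:R : R) != 0 by rewrite pnatr_eq0 -lt0n.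
split=> [/intrP[z xz]|[z ->]]; first by exists z; rewrite -xz mulfK.
by rewrite mulfVK// intr_int.
Qed.

Definition coords_in_quotient (q : nat) (v : V) : Prop :=
  forall k, coord X k v * q%:R \is a Num.int.

Lemma coords_in_quotientD q q' u v :
  coords_in_quotient q u -> coords_in_quotient q' v ->
  coords_in_quotient (q * q') (u + v).
Proof.
move=> uq vq k; rewrite linearD mulrDl natrM.
have -> : coord X k v * (q%:R * q'%:R) = q%:R * (coord X k v * q'%:R).
  by rewrite mulrCA.
by rewrite mulrA; apply: rpredD; apply: rpredM; rewrite ?natr_int ?uq ?vq.
Qed.

(* [b] is split along [v0], where [l v0 <> 0], using the integer nearest to
   [l b]. *)
Lemma split_along_relation (A delta D : R) (vs : seq V) b :
  0 <= A -> 1 <= D -> (forall v, v \in vs -> int_bounded X D v) ->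
  b \in <<vs>>%VS -> ~ lin_irrational X <<vs>> A delta b ->
  exists e p r (q : nat) (vs' : seq V),
    [/\ b = e + p + r, e \in <<vs>>%VS, r \in <<vs>>%VS & p \in <<vs'>>%VS] /\
    [/\ (<<vs'>> <= <<vs>>)%VS, (\dim <<vs'>> < \dim <<vs>>)%N &
      forall v, v \in vs' -> int_bounded X (cut_bound (2 ^+ d.+1 * A) D) v] /\
    [/\ forall k, `|coord X k e| <= delta * D, (0 < q)%N,
      q%:R <= 2 ^+ d * D * A & coords_in_quotient q r].
Proof.
move=> A0 D1 vsD bvs nirr.
have D0 : 0 <= D by lra.
have [l [lX [y yvs ly] [bs bsH lbs] lb]] : exists l : 'Hom(V, R^o),
    [/\ integer_map X l, nontrivial_on <<vs>> l,
        map_complexity_le X <<vs>> l A & dist_int (l b) < delta].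
  apply: contrapT => H; apply: nirr; split=> // l lX lnt lc.
  by rewrite leNgt; apply/negP => lt; apply: H; exists l.
(* Complexity is measured on a Hermite basis; this transfers the bound to the given generators. *)
have lB v : v \in vs -> `|l v : R| <= 2 ^+ d * D * A.
  move=> vvs; have [vX vB] := vsD v vvs.
  apply: (hermite_map_bound Xb erefl _ bsH) => //; last exact: memv_span.
  by move=> u /vsD[].
have [v0 v0vs lv0] : exists2 v, v \in vs & l v != 0.
  have [//|/span_killed H] := not_killed l vs.
  by case: ly; exact: H.
have [v0X v0B] := vsD v0 v0vs; have v0S := memv_span v0vs.
have [m mE] := dist_int_attained (l b : R).
have lv0int : (l v0 : R) \is a Num.int by exact: (int_map_int_span Xb).
have lv0ge1 : 1 <= `|l v0 : R| by exact: (norm_intr_ge1 lv0int lv0).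
(* [e] accounts for the distance from [l b] to the nearest integer [m] and [r] for [m] itself, so
   that [b - e - r] lies in the kernel of [l]. As [|l v0| >= 1], division by [l v0] does not enlarge
   [e], and [|l v0|] is a denominator of [r]. *)
pose e := ((l b - m%:~R) / l v0 : R) *: v0.
pose r := (m%:~R / l v0 : R) *: v0.
have lpE : l (b - e - r) = 0.
  have lZ (t : R) : l (t *: v0) = t * l v0 :> R by rewrite linearZ.
  have : (l b : R) - l e - l r = 0 by rewrite !lZ !mulfVK//; ring.
  by rewrite 2!linearB.
have /natrP[q qE] : `|l v0 : R| \is a Num.nat.
  exact: natr_norm_int.
have q0 : (0 < q)%N by rewrite -(ltr0n R) -qE (lt_le_trans ltr01).
exists e, (b - e - r), r, q, (map (elim_along l v0) vs).
rewrite span_kernel_cut//; split; last split.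
- split; rewrite ?memvZ//; first by rewrite -addrA subrK addrC subrK.
  by rewrite memv_cap memv_ker lpE eqxx andbT !memvB ?memvZ.
- split; [exact: capvSl|exact: (dim_cut v0S)|move=> v /mapP[u uvs ->]].
  have [uX uB] := elim_along_int_bounded Xb lX (vsD _ v0vs) (vsD _ uvs)
    (lB _ v0vs) (lB _ uvs).
  split=> // k; rewrite (le_trans (uB k))// /cut_bound exprS.
  by rewrite le_eqVlt; apply/orP; left; apply/eqP; ring.
- split=> // [k||k].
  + rewrite linearZ normrM ler_pM//; last exact: v0B.
    rewrite normrM normfV -mE.
    rewrite ler_pdivrMr ?(lt_le_trans ltr01)// (le_trans (ltW lb))//.
    rewrite ler_peMr// (le_trans _ (ltW lb))//.
    by rewrite mE.
  + by rewrite -qE lB.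
  + rewrite linearZ /= -qE -mulrA [coord _ _ _ * _]mulrC mulrA.
    rewrite rpredM ?v0X// -mulrA rpredM ?intr_int//.
    by rewrite normrEsign mulrCA mulVf// mulr1 rpredX// rpredN rpred1.
Qed.

(** Each use of [split_along_relation] lowers the dimension, so at most [n] rounds occur; small
    parts add up and denominators multiply. The last two clauses are what (i) requires. *)
Lemma lin_irrational_decomposition (A delta : R) n :
  1 <= A -> 0 <= delta -> forall (D : R) (vs : seq V) b,
  1 <= D -> (forall v, v \in vs -> int_bounded X D v) -> b \in <<vs>>%VS ->
  (\dim <<vs>> <= n)%N ->
  let Dn := iter n (cut_bound (2 ^+ d.+1 * A)) D in
  exists e p r (q : nat) (vs' : seq V),
    [/\ b = e + p + r, e \in <<vs>>%VS, p \in <<vs>>%VS & r \in <<vs>>%VS] /\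
    [/\ (<<vs'>> <= <<vs>>)%VS, lin_irrational X <<vs'>> A delta p &
      forall v, v \in vs' -> int_bounded X Dn v] /\
    [/\ forall k, `|coord X k e| <= n%:R * (delta * Dn), (0 < q)%N,
      q%:R <= Dn ^+ n & coords_in_quotient q r] /\
    (lin_irrational X <<vs>> A delta b ->
      [/\ e = 0, r = 0 & <<vs'>>%VS = <<vs>>%VS]) /\
    (~ lin_irrational X <<vs>> A delta b -> <<vs'>>%VS <> <<vs>>%VS).
Proof.
move=> A1 delta0.
have K1 : 1 <= 2 ^+ d.+1 * A.
  have pow1 : 1 <= 2 ^+ d.+1 :> R by apply: exprn_ege1; lra.
  exact: mulr_ege1.
have A0 : 0 <= A by lra.
elim: n => [|n IH] D vs b D1 vsD bvs dimn Dn;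
  have Dn1 : 1 <= Dn by apply: (le_trans D1); apply: iter_cut_bound_ge.
all: have [irr|nirr] := pselect (lin_irrational X <<vs>> A delta b).
- exists 0, b, 0, 1%N, vs; rewrite add0r addr0 !mem0v subvv.
  do !split=> //; move=> k; rewrite linear0 ?normr0 ?mul0r ?rpred0//.
(* In dimension 0 no form is nontrivial, so irrationality holds vacuously. *)
- case: nirr; split=> // l _ [x xvs lx] _; case: lx.
  have : (<<vs>> == 0)%VS by rewrite -dimv_eq0 -leqn0.
  by move=> /eqP S0; move: xvs; rewrite S0 memv0 => /eqP->; rewrite linear0.
- exists 0, b, 0, 1%N, vs; rewrite add0r addr0 !mem0v subvv.
  split; [by split|split; [split=> //|split; [split=> //|by []]]].
  + move=> v vvs; have [vX vB] := vsD v vvs; split=> // k.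
    by rewrite (le_trans (vB k))//; apply: iter_cut_bound_ge.
  + move=> k; rewrite linear0 normr0 mulr_ge0// mulr_ge0//.
    exact: le_trans ler01 Dn1.
  + by rewrite exprn_ege1.
  + by move=> k; rewrite linear0 mul0r rpred0.
have [e [p [r [q [vs1 [[bE eS rS pS1] [[sub dimlt vs1D] [eB q0 qB rq]]]]]]]] :=
  split_along_relation A0 D1 vsD bvs nirr.
set D' := cut_bound _ _ in vs1D.
have D'D : D <= D' by apply: (@iter_cut_bound_ge _ _ _ 1).
have D'1 : 1 <= D' by apply: le_trans D'D.
have Dn' : Dn = iter n (cut_bound (2 ^+ d.+1 * A)) D' by rewrite /Dn iterSr.
have DD' : D' <= Dn by rewrite Dn' iter_cut_bound_ge.
have [|e' [p' [r' [q' [vs2]]]]] := IH D' vs1 p D'1 vs1D pS1.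
  by rewrite -ltnS (leq_trans dimlt).
rewrite -Dn' => -[[pE eS' pS' rS'] [[sub' irr' vs2D] [[eB' q'0 qB' rq'] _]]].
exists (e + e'), p', (r' + r), (q' * q)%N, vs2; split; [|split; [|split]].
- split; rewrite ?memvD// ?(subvP sub)//.
  by rewrite bE pE !addrA.
- by split=> //; apply: subv_trans sub.
- split.
  + move=> k; rewrite linearD; apply: (le_trans (ler_normD _ _)).
    rewrite -add1n natrD mulrDl mul1r; apply: lerD (eB' k).
    apply: (le_trans (eB k)); rewrite ler_wpM2l//.
    exact: le_trans DD'.
  + by rewrite muln_gt0 q'0.
  + rewrite natrM exprSr ler_pM// (le_trans qB)//.
    apply: le_trans DD'; rewrite /D' /cut_bound -subr_ge0.
    have -> : 2 ^+ d.+1 * A * D ^+ 2 - 2 ^+ d * D * A =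
      (2 ^+ d * A * D) * (2 * D - 1) by rewrite exprS; ring.
    by rewrite !mulr_ge0 ?exprn_ge0//; lra.
  + exact: coords_in_quotientD.
(* The first split already lowers the dimension, so the final span is strictly smaller. *)
- split=> // _ eqS; move: dimlt.
  by rewrite -eqS ltnNge dimvS.
Qed.

End Decomposition.

(** * Brackets and the group law on coefficients of polynomial sequences *)

Section PolynomialBrackets.
Variables (R : realType) (V : vectType R) (br : V -> V -> V).
Variables (s : nat) (G : nat -> {vspace V}).
Hypotheses (brL : lie_algebra br) (GF : filtration br s G).

Lemma br0l y : br 0 y = 0.
Proof.
have := lie_linearl brL 1 0 0 y; rewrite !scale1r addr0 => H.
by apply: (addrI (br 0 y)); rewrite -H addr0.
Qed.

Lemma br0r y : br y 0 = 0.
Proof.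
have := lie_linearr brL 1 0 0 y; rewrite !scale1r addr0 => H.
by apply: (addrI (br y 0)); rewrite -H addr0.
Qed.

Lemma brDl x y z : br (x + y) z = br x z + br y z.
Proof. by rewrite -[x]scale1r (lie_linearl brL) !scale1r. Qed.

Lemma brDr x y z : br z (x + y) = br z x + br z y.
Proof. by rewrite -[x]scale1r (lie_linearr brL) !scale1r. Qed.

Lemma brZl a x z : br (a *: x) z = a *: br x z.
Proof. by rewrite -[a *: x]addr0 (lie_linearl brL) br0l addr0. Qed.

Lemma brZr a x z : br z (a *: x) = a *: br z x.
Proof. by rewrite -[a *: x]addr0 (lie_linearr brL) br0r addr0. Qed.

Lemma br_anti x y : br x y = - br y x.
Proof.
apply/eqP; rewrite -addr_eq0; apply/eqP.
have := lie_alt brL (x + y).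
by rewrite brDl !brDr !(lie_alt brL) add0r addr0.
Qed.

Lemma br_suml I (r : seq I) P (F : I -> V) z :
  br (\sum_(i <- r | P i) F i) z = \sum_(i <- r | P i) br (F i) z.
Proof. exact: (big_morph (br^~ z) (fun x y => brDl x y z) (br0l z)). Qed.

Lemma br_sumr I (r : seq I) P (F : I -> V) z :
  br z (\sum_(i <- r | P i) F i) = \sum_(i <- r | P i) br z (F i).
Proof. exact: (big_morph (br z) (fun x y => brDr x y z) (br0r z)). Qed.

(* Unlike in [poly_seq], all indices matter: the constant coefficient is zero,
   and those above [s] vanish because [G k = 0] for [k > s]. *)
Definition graded (f : nat -> V) : Prop :=
  f 0%N = 0 /\ forall i, f i \in G i.

(** A Cauchy product: the coefficients of the pointwise bracket of two polynomial sequences. *)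
Definition poly_br (f g : nat -> V) (k : nat) : V :=
  \sum_(i < k.+1) br (f i) (g (k - i)%N).

Lemma poly_br_graded f g : graded f -> graded g -> graded (poly_br f g).
Proof.
move=> [f0 fG] [g0 gG]; split=> [|k].
  by rewrite /poly_br big_ord1 f0 br0l.
apply: memv_suml => i _; have := filt_br GF (fG i) (gG (k - i)%N).
by rewrite subnKC // -ltnS.
Qed.

Lemma poly_seqE f n : graded f ->
  poly_seq s f n = \sum_(i < s.+1) (n%:~R ^+ i : R) *: f i.
Proof.
move=> [f0 _]; rewrite /poly_seq big_add1 /= big_mkord big_ord_recl.
by rewrite f0 scaler0 add0r; apply: eq_bigr.
Qed.

(** Truncation at [s] loses nothing: a product term of degree [i + j > s] lies in
    [G (i + j) = 0]. *)
Lemma poly_seq_br f g n : graded f -> graded g ->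
  poly_seq s (poly_br f g) n = br (poly_seq s f n) (poly_seq s g n).
Proof.
move=> fg gg; have fgg := poly_br_graded fg gg; rewrite !poly_seqE//.
have fG i : f i \in G i by case: fg.
have gG i : g i \in G i by case: gg.
rewrite br_suml.
transitivity (\sum_(k < s.+1) \sum_(i < s.+1 | (i <= k)%N)
   (n%:~R ^+ k : R) *: br (f i) (g (k - i)%N)).
  apply: eq_bigr => k _; rewrite scaler_sumr.
  by rewrite (big_ord_widen _ (fun i => n%:~R ^+ k *: br (f i) (g (k - i)%N))
    (ltn_ord k)).
rewrite (exchange_big_dep predT)//=; apply: eq_bigr => i _.
rewrite br_sumr.
have -> : \sum_(j < s.+1) br (n%:~R ^+ i *: f i) (n%:~R ^+ j *: g j) =
  \sum_(j < (s.+1 - i)%N) (n%:~R ^+ (i + j) : R) *: br (f i) (g j).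
  rewrite (big_ord_widen s.+1 (fun j => n%:~R ^+ (i + j) *: br (f i) (g j)))
    ?leq_subr// [RHS]big_mkcond /=; apply: eq_bigr => j _.
  rewrite brZl brZr scalerA exprD; case: ltnP => // sj.
  rewrite (_ : br _ _ = 0) ?scaler0//; apply/eqP.
  rewrite -memv0 -(filt_end GF (_ : s < i + j)%N); first exact: (filt_br GF).
  by move: sj; rewrite leq_subLR.
rewrite -(big_mkord (fun j => i <= j)%N
  (fun k => n%:~R ^+ k *: br (f i) (g (k - i)%N))).
rewrite -(big_mkord predT (fun j => n%:~R ^+ (i + j) *: br (f i) (g j))).
rewrite -(big_nat_widenl i 0 s.+1 predT)// -[in LHS](add0n i) big_addn.
by apply: eq_bigr => j _; rewrite addnK addnC.
Qed.

(** Reversing the summation and using antisymmetry shows that the sum equals its own negative. *)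
Lemma poly_br_alt f k : poly_br f f k = 0.
Proof.
have E : poly_br f f k = - poly_br f f k.
  rewrite {1}/poly_br (reindex_inj rev_ord_inj) /poly_br -sumrN.
  apply: eq_bigr => i _ /=; rewrite br_anti subSS subKn// -ltnS//.
have : 2%:R *: poly_br f f k = 0.
  by rewrite scaler_nat mulr2n {1}E addNr.
by move/eqP; rewrite scaler_eq0 pnatr_eq0 => /eqP.
Qed.

(** The constant coefficients vanish, so the terms [i = 0] and [i = k] drop out and only indices
    below [k] remain on both sides. *)
Lemma poly_br_local f f' g g' k : graded f -> graded f' -> graded g ->
    graded g' -> (forall i, (i < k)%N -> f i = f' i) ->
  (forall i, (i < k)%N -> g i = g' i) -> poly_br f g k = poly_br f' g' k.
Proof.
move=> [f0 _] [f'0 _] [g0 _] [g'0 _] ff' gg'; apply: eq_bigr => i _.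
case: (posnP i) => [->|i0]; first by rewrite f0 f'0 !br0l.
have := ltn_ord i; rewrite ltnS leq_eqVlt => /orP[/eqP ->|ik].
  by rewrite subnn g0 g'0 !br0r.
by rewrite ff'// gg'// ltn_subrL i0 (leq_ltn_trans _ ik).
Qed.

Lemma poly_br_in_h f g k : graded f -> graded g -> in_h br G k (poly_br f g k).
Proof.
move=> [_ fG] [_ gG] W _ _ HW; apply: memv_suml => i _.
by apply: (HW i) => //; rewrite -ltnS.
Qed.

(** The analogue of [nested_bracket] on coefficient sequences; a one-letter word stands for the
    sequence itself. *)
Fixpoint word_br (f g : nat -> V) (w : seq bool) : nat -> V :=
  if w is b :: w' then
    let h := if b then g else f in
    if w' is [::] then h else poly_br h (word_br f g w')
  else fun=> 0.

Lemma word_br_cons f g b b' w : word_br f g [:: b, b' & w] =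
  poly_br (if b then g else f) (word_br f g (b' :: w)).
Proof. by []. Qed.

Lemma word_br_graded f g w : graded f -> graded g -> graded (word_br f g w).
Proof.
move=> fg gg; elim: w => [|b [|b' w] IH].
- by split=> // i; rewrite mem0v.
- by case: b.
- by rewrite word_br_cons; apply: poly_br_graded => //; case: b.
Qed.

Lemma word_br_eval f g w n : graded f -> graded g ->
  poly_seq s (word_br f g w) n =
  nested_bracket br [seq (if b then poly_seq s g n else poly_seq s f n) | b <- w].
Proof.
move=> fg gg; elim: w => [|b [|b' w] IH].
- by rewrite /poly_seq big1 // => i _; rewrite scaler0.
- by case: b.
- have wg := word_br_graded (b' :: w) fg gg.
  by rewrite word_br_cons poly_seq_br//; [rewrite IH; case: b | case: b].
Qed.

(** Strong induction on the index [k]: the outer bracket uses the inner word only at indices below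
    [k]. A one-letter word must be excluded, as it returns the coefficient [k] itself. *)
Lemma word_br_local f f' g g' w k : graded f -> graded f' -> graded g ->
    graded g' -> (forall i, (i < k)%N -> f i = f' i) ->
    (forall i, (i < k)%N -> g i = g' i) -> (1 < size w)%N ->
  word_br f g w k = word_br f' g' w k.
Proof.
move=> fG f'G gG g'G; elim: k {-2}k (leqnn k) w => [|m IH] k km w ff' gg'.
  case: k km ff' gg' => // _ _ _ _.
  by rewrite (word_br_graded w fG gG).1 (word_br_graded w f'G g'G).1.
case: w => [|b [|b' w]] // _; rewrite !word_br_cons.
apply: poly_br_local; try by [case: b | exact: word_br_graded].
move=> i ik; have [w0|w1] := posnP (size w); last first.
  apply: IH => //; first by rewrite -ltnS (leq_trans ik).
  - by move=> j ji; apply: ff'; apply: ltn_trans ik.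
  - by move=> j ji; apply: gg'; apply: ltn_trans ik.
by rewrite (size0nil w0) /=; case: b'; [apply: gg'|apply: ff'].
Qed.

Lemma word_br_in_h f g w k : graded f -> graded g -> (1 < size w)%N ->
  in_h br G k (word_br f g w k).
Proof.
case: w => [|b [|b' w]] // fg gg _; rewrite word_br_cons.
by apply: poly_br_in_h; [case: b | exact: word_br_graded].
Qed.

(** The innermost bracket vanishes: for equal letters by [poly_br_alt], for different letters
    because one of them is the zero sequence. *)
Lemma word_br_eq0 f g w k : (forall i, f i = 0) \/ (forall i, g i = 0) ->
  (1 < size w)%N -> word_br f g w k = 0.
Proof.
move=> fg0; elim: w k => [|b [|b' w] IH] k // _; rewrite word_br_cons.
case: w IH => [_|b'' w IH].
  have [<-|bb'] := eqVneq b b'; first exact: poly_br_alt.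
  apply: big1 => i _; move: bb'; case: fg0 => h0.
    by case: b; case: b' => //=; rewrite h0 ?br0l ?br0r.
  by case: b; case: b' => //=; rewrite h0 ?br0l ?br0r.
by apply: big1 => i _; rewrite IH// br0r.
Qed.

(** The terms of degree at least 2 of the group law, split off because at index [k] they depend only
    on coefficients of lower index. *)
Definition bch_tail (f g : nat -> V) (k : nat) : V :=
  \sum_(2 <= n < s.+1) n%:R^-1 *:
    \sum_(w : n.-tuple bool) ratr (bch_coef w) *: word_br f g w k.

Definition bch_poly (f g : nat -> V) (k : nat) : V :=
  f k + g k + bch_tail f g k.

(** The series [log(exp X exp Y)] begins with [X + Y]. *)
Lemma bch_coef_letter b : bch_coef [:: b] = 1.
Proof.
rewrite /bch_coef /ncs_log /= big_nat1 /= /ncs_mul !big_ord_recl !big_ord0 /=.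
by rewrite /ncs_one /ncs_exp /=; case: b.
Qed.

Lemma bch_tail_graded f g : graded f -> graded g -> graded (bch_tail f g).
Proof.
move=> fg gg; split=> [|k].
  apply: big1 => n _; rewrite big1 ?scaler0// => w _.
  by rewrite (word_br_graded w fg gg).1 scaler0.
apply: memv_suml => n _; apply: memvZ; apply: memv_suml => w _.
by apply: memvZ; case: (word_br_graded w fg gg).
Qed.

Lemma bch_poly_graded f g : graded f -> graded g -> graded (bch_poly f g).
Proof.
move=> fg gg; have [t0 tG] := bch_tail_graded fg gg.
case: fg gg => [f0 fG] [g0 gG]; split=> [|k]; last by rewrite !memvD.
by rewrite /bch_poly f0 g0 t0 !addr0.
Qed.

(** Words of length 1 give the sum of the two sequences; for longer words the sums over powers of
    [n] and over words are interchanged and [word_br_eval] applies. *)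
Lemma bch_poly_eval f g n : (0 < s)%N -> graded f -> graded g ->
  poly_seq s (bch_poly f g) n = bch br s (poly_seq s f n) (poly_seq s g n).
Proof.
move=> s0 fg gg; rewrite /bch big_ltn// invr1 scale1r.
have -> : \sum_(w : 1.-tuple bool) ratr (bch_coef w) *:
    nested_bracket br [seq (if b then poly_seq s g n else poly_seq s f n) | b <- w]
    = poly_seq s f n + poly_seq s g n.
  rewrite (reindex_onto (fun b => [tuple b]) (fun w : 1.-tuple bool => thead w))/=.
    rewrite (eq_bigl predT) => [|b]; last by rewrite theadE eqxx.
    by rewrite big_bool /= !bch_coef_letter rmorph1 !scale1r addrC.
  by move=> [[|b [|b' w]] sz] _ //; apply: val_inj.
transitivity (poly_seq s f n + poly_seq s g n + poly_seq s (bch_tail f g) n).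
  by rewrite /poly_seq -!big_split /=; apply: eq_bigr => i _; rewrite -!scalerDr.
congr (_ + _); rewrite {1}/poly_seq /bch_tail.
under [LHS]eq_bigr do rewrite scaler_sumr.
rewrite exchange_big /=; apply: eq_big_nat => m /andP[m2 ms].
under [LHS]eq_bigr do rewrite scalerA mulrC -scalerA.
rewrite -scaler_sumr; congr (_ *: _).
under [LHS]eq_bigr do rewrite scaler_sumr.
rewrite exchange_big /=; apply: eq_bigr => w _.
under [LHS]eq_bigr do rewrite scalerA mulrC -scalerA.
rewrite -scaler_sumr; congr (_ *: _).
exact: word_br_eval.
Qed.

Lemma bch_tail_local f f' g g' k : graded f -> graded f' -> graded g ->
    graded g' -> (forall i, (i < k)%N -> f i = f' i) ->
    (forall i, (i < k)%N -> g i = g' i) ->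
  bch_tail f g k = bch_tail f' g' k.
Proof.
move=> fG f'G gG g'G ff' gg'; apply: eq_big_nat => n /andP[n2 _].
congr (_ *: _); apply: eq_bigr => w _; congr (_ *: _).
by apply: word_br_local; rewrite ?size_tuple.
Qed.

Lemma bch_tail_in_h f g k : graded f -> graded g ->
  in_h br G k (bch_tail f g k).
Proof.
move=> fg gg W W1 W2 W3; rewrite /bch_tail big_nat.
apply: memv_suml => n /andP[n2 _]; apply: memvZ; apply: memv_suml => w _.
by apply: memvZ; apply: word_br_in_h; rewrite ?size_tuple.
Qed.

Lemma bch_tail_eq0 f g k : (forall i, f i = 0) \/ (forall i, g i = 0) ->
  bch_tail f g k = 0.
Proof.
move=> fg0; rewrite /bch_tail big_nat big1// => n /andP[n2 _].
rewrite big1 ?scaler0// => w _.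
by rewrite word_br_eq0 ?scaler0// size_tuple.
Qed.

(** What the coefficient of [n ^ k] in [bch (bch e p) r] contains beyond [e k + p k + r k]. *)
Definition triple_tail (e p r : nat -> V) (k : nat) : V :=
  bch_tail e p k + bch_tail (bch_poly e p) r k.

Lemma triple_tail_local e e' p p' r r' k :
    graded e -> graded e' -> graded p -> graded p' -> graded r -> graded r' ->
    (forall i, (i < k)%N -> [/\ e i = e' i, p i = p' i & r i = r' i]) ->
  triple_tail e p r k = triple_tail e' p' r' k.
Proof.
move=> eG e'G pG p'G rG r'G E; congr (_ + _).
  by apply: bch_tail_local => // i /E[].
apply: bch_tail_local => //; try exact: bch_poly_graded.
  move=> i ik; rewrite /bch_poly; have [-> -> _] := E i ik; congr (_ + _).
  by apply: bch_tail_local => // j /ltn_trans/(_ ik)/E[].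
by move=> i /E[].
Qed.

(** By locality [e] and [r] may be replaced by zero sequences, after which each tail has a zero
    argument. In (i) this shows that the coefficients of [a] are met unmodified up to degree [j]. *)
Lemma triple_tail_eq0 e p r k : graded e -> graded p -> graded r ->
  (forall i, (i < k)%N -> e i = 0 /\ r i = 0) -> triple_tail e p r k = 0.
Proof.
move=> eG pG rG er0.
have zG : graded (fun=> 0) by split=> // i; rewrite mem0v.
rewrite (@triple_tail_local _ (fun=> 0) _ p _ (fun=> 0))//; last first.
  by move=> i /er0[].
by rewrite /triple_tail !bch_tail_eq0 ?addr0//; [right|left].
Qed.

Lemma triple_tail_in_h e p r k : graded e -> graded p -> graded r ->
  in_h br G k (triple_tail e p r k).
Proof.
move=> eG pG rG W W1 W2 W3; apply: memvD; first exact: (bch_tail_in_h eG pG).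
exact: (bch_tail_in_h (bch_poly_graded eG pG) rG).
Qed.

Lemma triple_tail_graded e p r : graded e -> graded p -> graded r ->
  graded (triple_tail e p r).
Proof.
move=> eG pG rG; have [t0 tG] := bch_tail_graded eG pG.
have [u0 uG] := bch_tail_graded (bch_poly_graded eG pG) rG.
by split=> [|k]; rewrite /triple_tail ?t0 ?u0 ?addr0// memvD.
Qed.

Lemma triple_product_eval e p r n : (0 < s)%N ->
    graded e -> graded p -> graded r ->
  bch br s (bch br s (poly_seq s e n) (poly_seq s p n)) (poly_seq s r n) =
  poly_seq s (fun k => e k + p k + r k + triple_tail e p r k) n.
Proof.
move=> s0 eG pG rG.
rewrite -!bch_poly_eval//; last exact: bch_poly_graded.
apply: eq_bigr => i _; congr (_ *: _); rewrite /bch_poly /triple_tail -!addrA.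
by congr (_ + (_ + _)); rewrite addrCA.
Qed.

End PolynomialBrackets.

(** * Bounds by powers *)

Section PolynomialGrowth.
Variable R : realType.

(** The range [x >= 2] lets powers of [x] absorb constants, so that each composite bound becomes a
    single power. *)
Definition poly_growth (f : R -> R) : Prop :=
  exists2 k : R, 0 <= k & forall x, 2 <= x -> 0 <= f x <= x `^ k.

Lemma powR_mono (x k k' : R) : 2 <= x -> k <= k' -> x `^ k <= x `^ k'.
Proof.
move=> x2; have x1 : 1 <= x by lra.
exact: ler_powR.
Qed.

Lemma powR_add (x k k' : R) : 2 <= x -> x `^ (k + k') = x `^ k * x `^ k'.
Proof.
move=> x2; have x0 : x != 0 by rewrite gt_eqF// (lt_le_trans _ x2).
by rewrite powRD// x0 implybT.
Qed.

Lemma poly_growth_cst (c : R) : 0 <= c -> poly_growth (fun=> c).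
Proof.
move=> c0; pose n := (Num.trunc c).+1.
exists n%:R => // x x2; rewrite c0 powR_mulrn; last lra.
have cn : c <= n%:R.
  by apply/ltW/truncnS_gt.
apply: (le_trans cn); apply: (@le_trans _ _ (2 ^+ n)).
  by rewrite -natrX ler_nat ltnW// ltn_expl.
by rewrite lerXn2r// nnegrE; lra.
Qed.

Lemma poly_growth_powR (k : R) : 0 <= k -> poly_growth (fun x => x `^ k).
Proof. by move=> k0; exists k => // x _; rewrite powR_ge0 lexx. Qed.

Lemma poly_growth_id : poly_growth id.
Proof.
exists 1 => // x x2; rewrite powRr1; last lra.
by rewrite lexx andbT; lra.
Qed.

Lemma poly_growthM f g : poly_growth f -> poly_growth g ->
  poly_growth (fun x => f x * g x).
Proof.
move=> [k k0 fk] [k' k'0 gk']; exists (k + k'); first exact: addr_ge0.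
move=> x x2; have /andP[f0 fx] := fk x x2; have /andP[g0 gx] := gk' x x2.
by rewrite mulr_ge0//= powR_add// ler_pM.
Qed.

Lemma poly_growthX f n : poly_growth f -> poly_growth (fun x => f x ^+ n).
Proof.
move=> fg; elim: n => [|n IH]; first exact: poly_growth_cst.
have [k k0 H] := poly_growthM fg IH.
by exists k => // x; rewrite exprS; apply: H.
Qed.

Lemma poly_growth_iter_cut_bound K D n : poly_growth K -> poly_growth D ->
  poly_growth (fun x => iter n (cut_bound (K x)) (D x)).
Proof.
move=> Kg Dg; elim: n => //= n IH.
by apply: poly_growthM => //; apply: (poly_growthX 2).
Qed.

End PolynomialGrowth.

(** * Complexity of subspaces, and the treatment of a single degree *)

Section Complexity.
Variables (R : realType) (V : vectType R) (d : nat) (X : d.-tuple V).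
Hypotheses (Xb : basis_of fullv X) (d0 : (0 < d)%N).

Lemma int_bounded_le (D D' : R) v :
  D <= D' -> int_bounded X D v -> int_bounded X D' v.
Proof. by move=> DD' [vX vD]; split=> // k; apply: le_trans DD'. Qed.

Lemma int_bounded_basis v : v \in X -> int_bounded X (1 : R) v.
Proof.
by case/(nthP 0) => i; rewrite size_tuple => id <-; exact: int_bounded_X.
Qed.

Lemma span_eq (S : {vspace V}) (ls : seq 'Hom(V, R^o)) (vs : seq V) :
  common_kernel ls S -> common_kernel ls <<vs>> -> S = <<vs>>%VS.
Proof.
move=> SK vK; apply/vspaceP => x; apply/idP/idP => H.
  by apply/vK/SK.
by apply/SK/vK.
Qed.

(** The factor [2 ^ d] is the cost, from [hermite_map_bound], of passing from values on a Hermite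
    basis to values on [X]; [d] iterations cover every codimension. *)
Definition spanning_bound (C : R) : R :=
  iter d (cut_bound (2 * d%:R * (2 ^+ d * C))) 1.

Lemma bounded_complexity_span (S : {vspace V}) (C : R) :
  1 <= C -> subspace_complexity_le X S C ->
  exists2 vs : seq V, S = <<vs>>%VS &
    forall v, v \in vs -> int_bounded X (spanning_bound C) v.
Proof.
move=> C1; have d1 : (1 : R) <= d%:R by rewrite ler1n.
have pow1 : 1 <= 2 ^+ d :> R by apply: exprn_ege1; lra.
have E1 : 1 <= 2 ^+ d * C by apply: mulr_ege1.
have K1 : 1 <= 2 * d%:R * (2 ^+ d * C).
  by rewrite mulr_ege1// mulr_ege1//; lra.
case=> [[-> _]|[Sfull [ls [lsC lsS]]]].
  exists (X : seq V); first by rewrite (span_basis Xb).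
  by move=> v /int_bounded_basis; apply: int_bounded_le; apply: iter_cut_bound_ge.
have [l lls|vs vsD vsK] := kernel_bounded_span (ls := ls) Xb d0 E1.
  have [lX [bs bsH lbs]] := lsC l lls; split=> // k.
  have [_ kB] := int_bounded_X Xb (ltn_ord k).
  rewrite -[2 ^+ d]mulr1.
  apply: (hermite_map_bound Xb (esym (span_basis Xb)) _ bsH ler01 _ lbs) => //.
  - by move=> v /int_bounded_basis[].
  - lra.
  - exact: memvf.
exists vs; first exact: span_eq lsS vsK.
move=> v /vsD; apply: int_bounded_le; apply: iter_cut_bound_mono => //.
exact: leq_subr.
Qed.

Lemma integer_map_rational (l : 'Hom(V, R^o)) :
  integer_map X l -> rational_map X l.
Proof.
move=> lX x xQ.
have [q qE] := fin_all_exists xQ.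
have [z zE] : exists z : 'I_d -> int, forall k : 'I_d, l X`_k = (z k)%:~R :> R.
  by exists (fun k => Num.floor (l X`_k : R)) => k; rewrite floorK ?lX.
exists (\sum_(k < d) q k * (z k)%:~R); rewrite (hom_expand Xb) rmorph_sum /=.
by apply: eq_bigr => k _; rewrite qE zE rmorphM /= ratr_int.
Qed.

(** The coordinate matrix of [X] is the identity, which is in Hermite normal form. *)
Lemma hermite_basis_full : hermite_basis X fullv X.
Proof.
have szX : size X = d by rewrite size_tuple.
split.
- by move=> x /int_bounded_basis[xX _]; rewrite memvf.
- exact: basis_free Xb.
- move=> x _ xX.
  pose z (i : nat) : int :=
    if insub i is Some k then Num.floor (coord X k x : R) else 0.
  exists (fun i => z i).
  rewrite -(big_mkord predT (fun i => (z i)%:~R *: X`_i)) szX big_mkord.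
  rewrite {1}(coord_basis Xb (memvf x)); apply: eq_bigr => k _.
  by rewrite /z valK floorK// xX.
- exists (cast_ord szX).
  have HE (i : 'I_(size X)) (j : 'I_d) :
      coord X j X`_i = (cast_ord szX i == j)%:R :> R.
    by rewrite -(coord_X Xb).
  split=> [i i'|i|i j|i i'] //; rewrite !mxE !HE.
  + by rewrite eqxx ltr01.
  + by move=> ji; rewrite -val_eqE /= gtn_eqF.
  + move=> i'i; rewrite eqxx -val_eqE /= ltn_eqF//.
    by rewrite lexx ltr01.
Qed.

Lemma bounded_span_complexity (D : R) (vs : seq V) : 1 <= D ->
  (forall v, v \in vs -> int_bounded X D v) ->
  rational_subspace X <<vs>> /\
  subspace_complexity_le X <<vs>> (iter d (cut_bound (2 * d%:R * D)) 1).
Proof.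
move=> D1 vsD; have [ls lsB lsK] := span_bounded_kernel Xb d0 D1 vsD.
split; first by exists ls; split=> // l /lsB[/integer_map_rational].
have [full|nfull] := pselect (<<vs>>%VS = fullv); [left|right]; split=> //.
  have d1 : (1 : R) <= d%:R by rewrite ler1n.
  by apply: iter_cut_bound_ge => //; rewrite mulr_ege1// mulr_ege1//; lra.
exists ls; split=> // l /lsB[lX lB]; split=> //.
exists (X : seq V); first exact: hermite_basis_full.
by move=> x /(nthP 0)[i]; rewrite size_tuple => id <-; exact: (lB (Ordinal id)).
Qed.

Lemma subspace_complexity_le_trans (S : {vspace V}) (C C' : R) :
  C <= C' -> subspace_complexity_le X S C -> subspace_complexity_le X S C'.
Proof.
move=> CC' [[-> C1]|[nf [ls [lsC K]]]]; [left|right]; split=> //.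
  exact: le_trans CC'.
exists ls; split=> // l /lsC[lX [bs bsH lB]]; split=> //.
by exists bs => // x /lB /le_trans; apply.
Qed.

(** At most [d] splittings occur, starting from the generators given by
    [bounded_complexity_span]. *)
Definition split_bound (A C : R) : R :=
  iter d (cut_bound (2 ^+ d.+1 * A)) (spanning_bound C).

Lemma degree_decomposition (A C delta : R) (S G : {vspace V}) b :
  1 <= A -> 1 <= C -> 0 <= delta -> (S <= G)%VS ->
  subspace_complexity_le X S C -> subspace_complexity_le X G C -> b \in G ->
  exists e p r (q : nat) (S' : {vspace V}),
    [/\ b = e + p + r, e \in G, p \in G & r \in G] /\
    [/\ rational_subspace X S',
        subspace_complexity_le X S'
          (iter d (cut_bound (2 * d%:R * split_bound A C)) 1) &
        lin_irrational X S' A delta p] /\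
    [/\ forall k, `|coord X k e| <= d%:R * (delta * split_bound A C),
        (0 < q)%N, q%:R <= split_bound A C ^+ d & coords_in_quotient X q r] /\
    (lin_irrational X S A delta b -> [/\ e = 0, r = 0 & S' = S]) /\
    (b \in S -> ~ lin_irrational X S A delta b -> (S' <= S)%VS /\ S' <> S).
Proof.
move=> A1 C1 delta0 SG SC GC bG.
have d1 : (1 : R) <= d%:R by rewrite ler1n.
have pow1 n : 1 <= 2 ^+ n :> R by apply: exprn_ege1; lra.
have D1 : 1 <= spanning_bound C.
  by apply: iter_cut_bound_ge => //; rewrite !mulr_ege1//; lra.
have E1 : 1 <= split_bound A C.
  by apply: (le_trans D1); apply: iter_cut_bound_ge => //; rewrite mulr_ege1.
(* The vector [b] need not lie in [S], for instance after tails have been subtracted; the splitting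
   then starts from [G], which contains [b]. *)
pose S0 := if b \in S then S else G.
have bS0 : b \in S0 by rewrite /S0; case: ifP.
have S0G : (S0 <= G)%VS by rewrite /S0; case: ifP.
have S0C : subspace_complexity_le X S0 C by rewrite /S0; case: ifP.
have S0S : b \in S -> S0 = S by rewrite /S0 => ->.
have [vs vsE vsD] := bounded_complexity_span C1 S0C.
have dimd : (\dim <<vs>> <= d)%N by rewrite -(dim_full Xb) dimvS ?subvf.
move: bS0 S0G S0S; rewrite vsE => bS0 S0G S0S.
have [e [p [r [q [vs' [[bE eS pS rS] [[sub irr vs'D] [rest [H1 H2]]]]]]]]] :=
  lin_irrational_decomposition Xb A1 delta0 D1 vsD bS0 dimd.
exists e, p, r, q, <<vs'>>%VS.
have [rat cpl] := bounded_span_complexity E1 vs'D.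
split; first by rewrite !(subvP S0G).
split=> //; split=> //; split=> [irrS|bS].
  by case: (irrS) => bS _; rewrite -(S0S bS); apply: H1; rewrite S0S.
by rewrite -(S0S bS) => /H2.
Qed.

(** The form [Q l] kills [h], is an integer on [r] and is small on [e], so its distance to the
    integers at [a] is at most [Q |l e|] plus [Q] times that of [l] at [p]. The factor [1 + 2 ^ d Y]
    in the hypothesis on [B'] pays for the term in [e] and leaves [Q B Z]. *)
Lemma filt_irrational_transfer (br : V -> V -> V) (G : nat -> {vspace V}) i
    (B B' C Y Z : R) (Q : nat) a e p r h :
  0 <= B -> 1 <= C -> 1 <= Y -> 0 <= Z -> subspace_complexity_le X (G i) C ->
  Y * B * (1 + 2 ^+ d * Y) <= B' ->
  a = e + p + r + h -> in_h br G i h -> e \in G i -> p \in G i ->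
  (forall k, `|coord X k e| <= Y * Z) ->
  (0 < Q)%N -> Q%:R <= Y -> coords_in_quotient X Q r ->
  filt_irrational X br G i B' (B' * Z) a ->
  filt_irrational X br G i B (B * Z) p.
Proof.
move=> B0 C1 Y1 Z0 GC BB' aE hh eG pG eB Q0 QY rQ [aG irr]; split=> // l lX lnt.
case=> bs bsH lbs lh.
have [vs vsE vsD] := bounded_complexity_span C1 GC.
have leB : `|l e : R| <= 2 ^+ d * (Y * Z) * B.
  apply: (hermite_map_bound Xb vsE _ bsH _ B0 lbs eG eB).
    by move=> v /vsD[].
  by rewrite mulr_ge0//; lra.
have QR0 : 0 < (Q%:R : R) by rewrite ltr0n.
pose l' : 'Hom(V, R^o) := (Q%:R : R) *: l.
have l'E x : l' x = Q%:R * (l x : R) :> R by rewrite scale_lfunE.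
have pow0 : 0 <= 2 ^+ d :> R by apply: exprn_ge0; lra.
have : B' * Z <= dist_int (l' a : R).
  apply: irr => [k|||x].
  - by rewrite l'E rpredM ?natr_int ?lX.
  - case: lnt => x xG lx; exists x => // /eqP; rewrite l'E mulf_eq0 gt_eqF//=.
    by move/eqP.
  - exists bs => // x xbs; rewrite l'E normrM normr_nat.
    apply: (@le_trans _ _ (Y * B)); first by apply: ler_pM => //; exact: lbs.
    apply: le_trans BB'; rewrite ler_peMr ?mulr_ge0//; first lra.
    by rewrite lerDl mulr_ge0//; lra.
  - by move=> /lh lx; rewrite l'E lx mulr0.
have [m mE] := dist_int_attained (l p : R).
have /intrP[z zE] : (l r : R) * Q%:R \is a Num.int.
  rewrite (hom_expand Xb) mulr_suml rpred_sum// => k _.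
  by rewrite mulrAC rpredM ?lX.
have la : l' a = Q%:R * (l e : R) + Q%:R * ((l p : R) - m%:~R)
    + (Q%:Z * m + z)%:~R :> R.
  have lD u v : l (u + v) = (l u : R) + l v by exact: linearD.
  by rewrite l'E aE !lD (lh _ hh) intrD intrM -zE -pmulrn; ring.
have := dist_int_le (l' a : R) (Q%:Z * m + z).
rewrite la addrK => le1 le2.
have le3 : B' * Z <= Q%:R * (2 ^+ d * (Y * Z) * B) + Q%:R * dist_int (l p : R).
  apply: (le_trans le2); apply: (le_trans le1).
  apply: (le_trans (ler_normD _ _)); rewrite !normrM normr_nat -mE.
  by rewrite lerD2r ler_wpM2l// ltW.
rewrite -(ler_pM2l QR0).
have le4 : Q%:R * B * (1 + 2 ^+ d * Y) * Z <= B' * Z.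
  rewrite ler_wpM2r//; apply: le_trans BB'; rewrite !ler_wpM2r//.
  by rewrite addr_ge0// mulr_ge0//; lra.
move: le3 le4; set u := Q%:R; set w := 2 ^+ d; set D := dist_int _.
move=> le3 le4; have := le_trans le4 le3.
have -> : u * B * (1 + w * Y) * Z = u * (B * Z) + u * (w * (Y * Z) * B) by ring.
by rewrite addrC lerD2l.
Qed.

End Complexity.

(** * Solving the factorization degree by degree *)

Section DegreeByDegree.
Variables (R : realType) (V : vectType R) (br : V -> V -> V).
Variables (s : nat) (G : nat -> {vspace V}).
Hypotheses (brL : lie_algebra br) (GF : filtration br s G).

(* Since [triple_tail e p r k] only involves coefficients of index below [k],
   the factorization [a = e * p * r] is solved one degree at a time, with no
   use of the associativity of [bch]. *)
Lemma solve_degree_by_degree (T : Type) (t0 : T)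
    (P : nat -> V -> V -> V -> V -> T -> Prop) (a : nat -> V) :
  adapted s G a ->
  (forall k, (0 < k <= s)%N -> forall b, b \in G k -> exists e p r t,
     [/\ b = e + p + r, e \in G k, p \in G k & r \in G k] /\ P k b e p r t) ->
  exists (e p r : nat -> V) (t : nat -> T),
    [/\ graded G e, graded G p & graded G r] /\
    forall k, (0 < k <= s)%N ->
      let b := a k - triple_tail br s e p r k in
      b = e k + p k + r k /\ P k b (e k) (p k) (r k) (t k).
Proof.
move=> aG step.
(* Induction on the largest degree [m] already solved. *)
suff /(_ s) : forall m, exists (e p r : nat -> V) (t : nat -> T),
    [/\ graded G e, graded G p & graded G r] /\
    forall k, (0 < k <= s)%N -> (k <= m)%N ->
      let b := a k - triple_tail br s e p r k in
      b = e k + p k + r k /\ P k b (e k) (p k) (r k) (t k).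
  move=> [e [p [r [t [gr H]]]]]; exists e, p, r, t; split=> // k ks.
  by apply: H => //; case/andP: ks.
have zG : graded G (fun=> 0) by split=> // i; rewrite mem0v.
elim=> [|m [e [p [r [t [[eG pG rG] H]]]]]].
  by exists (fun=> 0), (fun=> 0), (fun=> 0), (fun=> t0); split=> // k /andP[k0 _];
    rewrite leqNgt k0.
have [ms|sm] := leqP m.+1 s; last first.
  exists e, p, r, t; split=> // k ks km; apply: H => //.
  by rewrite -ltnS (leq_ltn_trans _ sm)//; case/andP: ks.
have tG := triple_tail_graded brL GF eG pG rG.
have bG : a m.+1 - triple_tail br s e p r m.+1 \in G m.+1.
  by rewrite memvB ?aG//; case: tG.
have [e1 [p1 [r1 [t1 [[bE e1G p1G r1G] P1]]]]] := step m.+1 ms _ bG.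
pose upd U (f : nat -> U) u i := if i == m.+1 then u else f i.
have updG f u : graded G f -> u \in G m.+1 -> graded G (upd V f u).
  move=> [f0 fG] uG; split=> [|i]; first by rewrite /upd.
  by rewrite /upd; case: eqP => [->|].
have updlt U (f : nat -> U) u i : (i < m.+1)%N -> upd U f u i = f i.
  by move=> im; rewrite /upd ltn_eqF.
(* Changing the sequences at index [m + 1] leaves the tails up to [m + 1] unchanged, so the
   equations already solved persist. *)
have tE k : (k <= m.+1)%N ->
    triple_tail br s (upd V e e1) (upd V p p1) (upd V r r1) k =
    triple_tail br s e p r k.
  move=> km; apply: (triple_tail_local brL GF); try by [|exact: updG].
  by move=> i ik; rewrite !updlt// (leq_trans ik).
exists (upd V e e1), (upd V p p1), (upd V r r1), (upd T t t1).
split; first by split; exact: updG.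
move=> k ks km; rewrite tE//.
move: km; rewrite leq_eqVlt => /orP[/eqP->|km]; first by rewrite /upd eqxx.
by rewrite !updlt//; apply: H.
Qed.

End DegreeByDegree.

(** * Choice of the exponents and assembly of the factorization *)

Lemma prod_nat_bound (R : realType) (q : nat -> nat) (E : R) s :
  (forall k, (0 < k <= s)%N -> (q k)%:R <= E) ->
  (\prod_(1 <= k < s.+1) q k)%:R <= E ^+ s.
Proof.
elim: s => [|s IH] qE; first by rewrite big_geq.
rewrite big_nat_recr//= natrM exprSr ler_pM// ?qE ?leqnn//.
by apply: IH => k /andP[k0 ks]; rewrite qE// k0 leqW.
Qed.

Unset Implicit Arguments.

Theorem theorem5p10 (R : realType) (d s : nat) (C0 : R) :
  (0 < d)%N -> (0 < s)%N -> 1 <= C0 ->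
  exists C1 c : R, 1 <= C1 /\ 1 < c /\
  forall A M N : nat,
    (2 <= A)%N -> (2 <= M)%N -> (1 <= N)%N -> (d < A * M)%N ->
  forall (V : vectType R) (br : V -> V -> V) (G : nat -> {vspace V})
    (X : d.-tuple V),
    lie_algebra br -> lie_nilpotent br -> filtration br s G ->
    basis_of fullv X -> structure_constants_height_le X br M ->
  forall (a : nat -> V) (S : nat -> {vspace V}),
    adapted s G a ->
    (forall i, (0 < i <= s)%N -> (S i <= G i)%VS) ->
    (forall i, (0 < i <= s)%N ->
       rational_subspace X (S i) /\
       subspace_complexity_le X (S i) (A%:R `^ C0)) ->
    (forall i, (i <= s)%N ->
       rational_subspace X (G i) /\
       subspace_complexity_le X (G i) (A%:R `^ C0)) ->
  exists (e p' r : nat -> V) (S' : nat -> {vspace V}),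
    [/\ adapted s G e, adapted s G p' & adapted s G r] /\
    (forall n : int,
       poly_seq s a n =
       bch br s (bch br s (poly_seq s e n) (poly_seq s p' n))
         (poly_seq s r n)) /\
    (forall i, (0 < i <= s)%N ->
       rational_subspace X (S' i) /\
       subspace_complexity_le X (S' i) (A%:R `^ C1)) /\
    poly_lin_irrational X s S' A%:R N p' /\
    (exists Q : nat,
       (0 < Q)%N /\ Q%:R <= (A * M)%:R `^ C1 /\ poly_rational X s Q r) /\
    poly_small X s ((A * M)%:R `^ C1) N e /\
    (* (i): linear irrationality in S_j is only defined for elements of S_j *)
    (forall j, (0 < j <= s)%N ->
       (forall k, (0 < k < j)%N ->
          lin_irrational X (S k) A%:R (A%:R / N%:R ^+ k) (a k)) ->
       a j \in S j ->
       ~ lin_irrational X (S j) A%:R (A%:R / N%:R ^+ j) (a j) ->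
       (forall k, (0 < k < j)%N -> S' k = S k) /\
       (S' j <= S j)%VS /\ S' j <> S j) /\
    (* (ii) *)
    (forall B : R, (A * M)%:R < B ->
       poly_filt_irrational X br s G (B `^ c) N a ->
       poly_filt_irrational X br s G B N p').
Proof.
move=> d0 s0 C01; have C00 : 0 <= C0 by lra.
have Cg : poly_growth (fun x : R => x `^ C0) by apply: poly_growth_powR.
have pow0 n : 0 <= 2 ^+ n :> R by apply: exprn_ge0; lra.
have spg : poly_growth (fun x => spanning_bound d (x `^ C0)).
  apply: (poly_growth_iter_cut_bound (K := fun x => 2 * d%:R * (2 ^+ d * x `^ C0))
    (D := fun=> 1)); last exact: poly_growth_cst.
  apply: poly_growthM; first by apply: poly_growth_cst; rewrite mulr_ge0.
  by apply: poly_growthM => //; apply: poly_growth_cst.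
have splg : poly_growth (fun x => split_bound d x (x `^ C0)).
  apply: (poly_growth_iter_cut_bound (K := fun x => 2 ^+ d.+1 * x)) => //.
  by apply: poly_growthM; [exact: poly_growth_cst | exact: poly_growth_id].
have [k1 k10 H1] : poly_growth (fun x : R =>
    iter d (cut_bound (2 * d%:R * split_bound d x (x `^ C0))) 1).
  apply: (poly_growth_iter_cut_bound
    (K := fun x => 2 * d%:R * split_bound d x (x `^ C0)) (D := fun=> 1));
    last exact: poly_growth_cst.
  by apply: poly_growthM => //; apply: poly_growth_cst; rewrite mulr_ge0.
have [k2 k20 H2] : poly_growth (fun x : R =>
    d%:R * (x * split_bound d x (x `^ C0))).
  apply: poly_growthM; first exact: poly_growth_cst.
  by apply: poly_growthM => //; exact: poly_growth_id.
have [k3 k30 H3] : poly_growth (fun x : R =>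
    (split_bound d x (x `^ C0) ^+ d) ^+ s) by do 2!apply: poly_growthX.
have [k4 k40 H4] : poly_growth (fun=> 1 + 2 ^+ d : R).
  by apply: poly_growth_cst; rewrite addr_ge0.
(* [k1] controls the complexity of the new subspaces, [k2] the size of [e] and [k3] the common
   denominator of [r]. *)
pose C1 := 1 + k1 + k2 + k3.
have C1ge1 : 1 <= C1 by rewrite /C1; lra.
(* In the exponent for (ii), [k4] absorbs [1 + 2 ^ d], the two [C1] come from the square of
   [Y = B ^ C1], and 1 from the factor [B] in [filt_irrational_transfer]. *)
exists C1, (k4 + C1 + C1 + 1); split=> //; split; first lra.
move=> A M N A2 M2 N1 _ V br G X brL _ GF Xb _ a S aG SG SC GC.
have x2 : 2 <= A%:R :> R by rewrite ler_nat.
have A1 : 1 <= A%:R :> R by lra.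
have N0 : 0 < N%:R :> R by rewrite ltr0n.
have AC1 : 1 <= A%:R `^ C0 by rewrite -[leLHS](powRr0 A%:R); exact: powR_mono.
have AM : A%:R <= (A * M)%:R :> R.
  by rewrite ler_nat leq_pmulr// (leq_trans _ M2).
have boundAM k y : k <= C1 -> y <= A%:R `^ k -> y <= (A * M)%:R `^ C1 :> R.
  move=> kC yk; apply: (le_trans yk); apply: (le_trans (powR_mono x2 kC)).
  by apply: ge0_ler_powR; rewrite ?nnegrE//; lra.
have delta0 k : 0 <= A%:R / N%:R ^+ k :> R by rewrite divr_ge0 ?exprn_ge0.
(* The outcome of degree [k]; [t] pairs a denominator of [r] with the new subspace. *)
pose P k (b e p r : V) (t : nat * {vspace V}) :=
  [/\ rational_subspace X t.2,
      subspace_complexity_le X t.2 (iter d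
        (cut_bound (2 * d%:R * split_bound d A%:R (A%:R `^ C0))) 1) &
      lin_irrational X t.2 A%:R (A%:R / N%:R ^+ k) p] /\
  [/\ forall i, `|coord X i e| <=
        d%:R * (A%:R / N%:R ^+ k * split_bound d A%:R (A%:R `^ C0)),
      (0 < t.1)%N, t.1%:R <= split_bound d A%:R (A%:R `^ C0) ^+ d &
      coords_in_quotient X t.1 r] /\
  (lin_irrational X (S k) A%:R (A%:R / N%:R ^+ k) b ->
     [/\ e = 0, r = 0 & t.2 = S k]) /\
  (b \in S k -> ~ lin_irrational X (S k) A%:R (A%:R / N%:R ^+ k) b ->
     (t.2 <= S k)%VS /\ t.2 <> S k).
have [|e [p [r [t [[eG pG rG] H]]]]] :=
    solve_degree_by_degree brL GF (1%N, 0%VS) (P := P) aG.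
  move=> k ks b bG; have [_ Sk] := SC k ks.
  have [_ Gk] := GC k (proj2 (andP ks)).
  have [e [p [r [q [S' [bE rest]]]]]] := degree_decomposition Xb d0 A1 AC1
    (delta0 k) (SG k ks) Sk Gk bG.
  by exists e, p, r, (q, S').
have aE k : (0 < k <= s)%N ->
    a k = e k + p k + r k + triple_tail br s e p r k.
  by move=> /H[<- _]; rewrite subrK.
pose Q := (\prod_(1 <= k < s.+1) (t k).1)%N.
have QC1 : Q%:R <= (A * M)%:R `^ C1 :> R.
  apply: (boundAM k3); first by rewrite /C1; lra.
  have /andP[_ H3A] := H3 _ x2; apply: le_trans H3A.
  by apply: prod_nat_bound => k /H[_ [_ [[]]]].
have Q0 : (0 < Q)%N.
  rewrite /Q big_nat; elim/big_ind: _ => // [m n m0 n0|k ks].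
    by rewrite muln_gt0 m0.
  by have [_ [_ [[]]]] := H k ks.
have rQ k : (0 < k <= s)%N -> coords_in_quotient X Q (r k).
  move=> ks i; have [_ [_ [[_ _ _ rk] _]]] := H k ks.
  have /dvdnP[m ->] : ((t k).1 %| Q)%N.
    rewrite /Q (bigD1_seq k) ?iota_uniq ?mem_index_iota ?ltnS//=.
    exact: dvdn_mulr.
  by rewrite natrM mulrCA rpredM ?natr_int ?rk.
have eC1 k : (0 < k <= s)%N -> forall i,
    `|coord X i (e k)| <= (A * M)%:R `^ C1 / N%:R ^+ k.
  move=> ks i; have [_ [_ [[ek _ _ _] _]]] := H k ks.
  apply: (le_trans (ek i)).
  have -> : d%:R * (A%:R / N%:R ^+ k * split_bound d A%:R (A%:R `^ C0)) =
    d%:R * (A%:R * split_bound d A%:R (A%:R `^ C0)) / N%:R ^+ k.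
    by rewrite mulrAC !mulrA.
  rewrite ler_wpM2r ?invr_ge0 ?exprn_ge0//.
  apply: (boundAM k2); first by rewrite /C1; lra.
  by have /andP[] := H2 _ x2.
exists e, p, r, (fun k => (t k).2).
split; first by split=> i _; [case: eG|case: pG|case: rG].
split.
  move=> n; rewrite (triple_product_eval brL GF)//.
  by apply: eq_big_nat => i; rewrite ltnS => irange; rewrite aE.
split.
  move=> i irange; have [_ [[rat cpl _] _]] := H i irange; split=> //.
  apply: subspace_complexity_le_trans cpl.
  have /andP[_ H1A] := H1 _ x2; apply: (le_trans H1A); apply: powR_mono => //.
  by rewrite /C1; lra.
split; first by move=> i irange; have [_ [[]]] := H i irange.
split.
  exists Q; split=> //; split=> // i irange k.
  by apply/int_quotientP => //; apply: rQ.
split; first exact: eC1.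
split.
  (* For (i), by strong induction on [k < j] the tail vanishes, so the vector treated in degree [k]
     is [a k] itself, which is irrational in [S k] and left unchanged. The tail in degree [j] then
     vanishes as well. *)
  move=> j /andP[j0 js] irr aSj nirr.
  have tail0 k : (k <= j)%N -> (forall i, (0 < i < k)%N -> e i = 0 /\ r i = 0) ->
      triple_tail br s e p r k = 0.
    move=> kj er0; apply: (triple_tail_eq0 brL GF) => // i ik.
    case: (posnP i) => [->|i0]; first by case: eG rG => e0 _ [r0 _].
    by apply: er0; rewrite i0.
  have below k : (0 < k < j)%N -> [/\ e k = 0, r k = 0 & (t k).2 = S k].
    elim/ltn_ind: k => k IH /andP[k0 kj].
    have ks : (0 < k <= s)%N by rewrite k0 (leq_trans (ltnW kj)).
    have tk : triple_tail br s e p r k = 0.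
      apply: (tail0 k (ltnW kj)) => i /andP[i0 ik].
      by have [] := IH i ik _; first by rewrite i0 (ltn_trans ik).
    have [_ [_ [_ [+ _]]]] := H k ks; rewrite tk subr0; apply.
    by apply: irr; rewrite k0.
  split; first by move=> k /below[].
  have tj : triple_tail br s e p r j = 0 by apply: tail0 => // i /below[].
  have jrange : (0 < j <= s)%N by rewrite j0.
  have [_ [_ [_ [_ +]]]] := H j jrange; rewrite tj subr0; exact.
move=> B AMB irr i irange.
have B2 : 2 <= B by lra.
have [aGi _] := irr i irange.
have Y1 : 1 <= B `^ C1.
  by rewrite -[leLHS](powRr0 B); apply: powR_mono => //; rewrite /C1; lra.
have AMC1 : (A * M)%:R `^ C1 <= B `^ C1.
  by apply: ge0_ler_powR; rewrite ?nnegrE//; lra.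
have Z0 : 0 <= (N%:R ^+ i)^-1 :> R by rewrite invr_ge0 exprn_ge0.
have [_ Gi] := GC i (proj2 (andP irange)).
(* For (ii), [Y = B ^ C1] bounds both [Q] and the size of [e] because [AM < B], and [Z] is the
   inverse of [N ^ i]. *)
apply: (filt_irrational_transfer (a := a i) (e := e i) (r := r i) (Q := Q)
  (C := A%:R `^ C0) (Y := B `^ C1) (B' := B `^ (k4 + C1 + C1 + 1))
  Xb d0 _ AC1 Y1 Z0 Gi _ (aE i irange)) => //; last exact: irr.
- lra.
- have /andP[_ k4B] := H4 _ B2.
  rewrite (@powR_add _ B _ 1 B2) 2!(@powR_add _ B _ C1 B2) powRr1; last lra.
  set Y := B `^ C1 in Y1 *; set K := B `^ k4 in k4B *.
  (* Since [Y >= 1], the factor [1 + 2 ^ d Y] is at most [(1 + 2 ^ d) Y], hence at most [K Y]. *)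
  have -> : K * Y * Y * B = Y * B * (K * Y) by ring.
  have B0 : 0 <= B by lra.
  have Y0 : 0 <= Y by lra.
  rewrite ler_wpM2l// ?mulr_ge0//; apply: (@le_trans _ _ ((1 + 2 ^+ d) * Y)).
    by rewrite mulrDl mul1r lerD2r.
  by rewrite ler_wpM2r.
- exact: triple_tail_in_h.
- by case: eG.
- by case: pG.
- move=> k; apply: (le_trans (eC1 i irange k)).
  by rewrite ler_wpM2r.
- exact: le_trans AMC1.
- exact: rQ.
Qed.
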